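(* Let $L\subseteq\{0,1\}^*$ be a finite language. Then the graph class $\mathcal{G}_{\langle L\rangle}$ has speed at most $2^{O(n\log n)}$, i.e., there is a constant $c>0$ (depending only on $L$) such that $|\mathcal{G}_{\langle L\rangle}^n|\le n^{cn}$ for all $n\ge 2$; hence $\mathcal{G}_{\langle L\rangle}$ has at most factorial speed.
   Context: For a binary word $u$, $\widetilde{u}$ denotes the word obtained by exchanging $0$ and $1$. For $L\subseteq\{0,1\}^*$, $\langle L\rangle=\{u,\widetilde u\mid u\in L\}$; $L$ is 0-1-symmetric if $L=\langle L\rangle$. For a word $w$ and distinct letters $a,b$, $h_{a,b}(w)\in\{0,1\}^*$ is obtained from $w$ by replacing each $a$ by $0$, each $b$ by $1$, and deleting all other letters. For a 0-1-symmetric $L$ and a word $w$ whose set of occurring letters is $V$, $G(L,w)$ is the graph with vertex set $V$ in which distinct $u,v\in V$ are adjacent iff $h_{u,v}(w)\in L$. $\mathcal{G}_L$ is the class of all graphs isomorphic to $G(L,w)$ for some word $w$. For a graph class $\mathcal{C}$ (closed under isomorphism), $\mathcal{C}^n$ is the set of graphs in $\mathcal{C}$ with vertex set $\{1,\dots,n\}$ and $n\mapsto|\mathcal{C}^n|$ is the speed of $\mathcal{C}$. $\mathcal{C}$ has at most factorial speed if there is $c>0$ with $|\mathcal{C}^n|\le n^{cn}$. *)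

(* Defs.v *)
From HB Require Import structures.
From mathcomp Require Import all_boot all_order all_algebra.
From mathcomp Require Import boolp classical_sets cardinality reals exp.

Set Implicit Arguments.
Unset Strict Implicit.
Unset Printing Implicit Defensive.

Import Order.TTheory GRing.Theory Num.Theory.

(* A binary word is a [seq bool], with [false] for 0 and [true] for 1. *)
Definition flip01 (u : seq bool) : seq bool := map negb u.

Definition sym01_closure (L : set (seq bool)) : set (seq bool) :=
  (L `|` flip01 @` L)%classic.

Definition sym01 (L : set (seq bool)) : Prop := L = sym01_closure L.

(* Meaningful for a != b only. *)
Definition proj01 (A : eqType) (a b : A) (w : seq A) : seq bool :=
  [seq x == b | x <- w & (x == a) || (x == b)].

Record sgraph (V : finType) := SGraph {
  edges : {set {set V}};
  edges_card2 : [forall e in edges, #|e| == 2] }.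

HB.instance Definition _ (V : finType) := [isSub for @edges V].
HB.instance Definition _ (V : finType) := [Finite of sgraph V by <:].

Definition adj (V : finType) (G : sgraph V) (u v : V) : bool :=
  [set u; v]%SET \in edges G.

Definition graph_iso (V W : finType) (G : sgraph V) (H : sgraph W) : Prop :=
  exists2 f : V -> W, bijective f & forall u v, adj H (f u) (f v) = adj G u v.

Section WordGraph.
Variables (L : set (seq bool)) (A : choiceType) (w : seq A).

(* [seq_sub w] is the type of the letters occurring in [w]. *)
Definition word_edges : {set {set seq_sub w}} :=
  [set e : {set seq_sub w} | [exists u : seq_sub w, exists v : seq_sub w,
     [&& e == [set u; v], u != v & `[< L (proj01 (val u) (val v) w) >]]]]%SET.

Fact word_edges_card2 : [forall e in word_edges, #|e| == 2].
Proof.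
apply/forall_inP => e; rewrite inE => /existsP[u /existsP[v]].
by case/and3P => /eqP-> uv _; rewrite cards2 uv.
Qed.

Definition word_graph : sgraph (seq_sub w) := SGraph word_edges_card2.

End WordGraph.

Lemma flip01_proj01 (A : eqType) (a b : A) (w : seq A) :
  a != b -> flip01 (proj01 a b w) = proj01 b a w.
Proof.
move=> ab; rewrite /flip01 /proj01 -map_comp.
rewrite (@eq_filter _ _ (fun x => (x == b) || (x == a))); last first.
  by move=> x; rewrite orbC.
apply/eq_in_map => x; rewrite mem_filter => /andP[/orP[]/eqP-> _] /=.
  by rewrite eqxx eq_sym (negbTE ab).
by rewrite eqxx ab.
Qed.

(* Since edges are unordered, this characterization needs [L] to be symmetric;
   [word_graph] is only meaningful for such [L]. *)
Lemma adj_word_graph (L : set (seq bool)) (A : choiceType) (w : seq A)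
    (u v : seq_sub w) :
  sym01 L -> u != v ->
  adj (word_graph L w) u v <-> L (proj01 (val u) (val v) w).
Proof.
move=> symL uv; split; last first.
  move=> Luv; rewrite /adj inE; apply/existsP; exists u.
  by apply/existsP; exists v; rewrite eqxx uv; apply/asboolP.
rewrite /adj inE => /existsP[a /existsP[b /and3P[/eqP E ab /asboolP Lab]]].
have /set2P[ua|ub] : u \in [set a; b]%SET by rewrite -E set21.
  have /set2P[va|->] : v \in [set a; b]%SET by rewrite -E set22.
    by rewrite ua va eqxx in uv.
  by rewrite ua.
have /set2P[->|vb] : v \in [set a; b]%SET by rewrite -E set22.
  rewrite ub symL; right; exists (proj01 (val a) (val b) w) => //.
  exact: flip01_proj01.
by rewrite ub vb eqxx in uv.
Qed.

Lemma sym01_closureP (L : set (seq bool)) : sym01 (sym01_closure L).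
Proof.
apply/seteqP; split=> [u|u [//|[v [Lv|[v' Lv' <-]] <-]]]; first by left.
  by right; exists v.
left; rewrite /flip01 -map_comp map_id_in // => b _ /=; exact: negbK.
Qed.

Definition graph_class := forall V : finType, set (sgraph V).

Definition word_graph_class (L : set (seq bool)) : graph_class := fun V G =>
  exists (A : choiceType) (w : seq A), graph_iso G (word_graph L w).

(* The labelled vertex set {1, ..., n} is represented by ['I_n]. *)
Definition speed (C : graph_class) (n : nat) : nat :=
  #|[set G : sgraph 'I_n | `[< C _ G >]]%SET|.

Definition at_most_factorial_speed (R : realType) (C : graph_class) : Prop :=
  exists c : R, (0 < c)%R /\
    forall n : nat, ((speed C n)%:R <= n%:R `^ (c * n%:R))%R.

(* Main.v *)
Require Import Defs.
From HB Require Import structures.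
From mathcomp Require Import all_boot all_order all_algebra.
From mathcomp Require Import boolp classical_sets cardinality reals exp.

Set Implicit Arguments.
Unset Strict Implicit.
Unset Printing Implicit Defensive.

(** Let [k] bound the lengths of the words of [L].  The projection of [w] to
    two letters has length the sum of their multiplicities, so a letter
    occurring more than [k] times in [w] is an isolated vertex.  Deleting these
    letters leaves a word of length at most [k * n] over [n] letters which still
    determines the graph, so there are at most [n.+1 ^ (k * n)] graphs. *)

Lemma size_proj01 (A : eqType) (a b : A) (w : seq A) :
  a != b -> size (proj01 a b w) = count_mem a w + count_mem b w.
Proof.
move=> ab; rewrite /proj01 size_map size_filter -count_predUI.
rewrite [X in _ + X](_ : _ = 0) ?addn0 //.
apply/eqP; rewrite -leqn0 leqNgt -has_count; apply/hasPn => x _ /=.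
by apply: contra ab => /andP[/eqP<- /eqP<-].
Qed.

Lemma proj01_map (A B : eqType) (f : A -> B) (a b : A) (w : seq A) :
  injective f -> proj01 (f a) (f b) (map f w) = proj01 a b w.
Proof.
move=> injf; rewrite /proj01 filter_map -map_comp.
rewrite (@eq_filter _ _ (fun x => (x == a) || (x == b))); last first.
  by move=> x /=; rewrite !(inj_eq injf).
by apply: eq_map => x /=; rewrite (inj_eq injf).
Qed.

Lemma proj01_filter (A : eqType) (P : pred A) (a b : A) (w : seq A) :
  P a -> P b -> proj01 a b (filter P w) = proj01 a b w.
Proof.
move=> Pa Pb; rewrite /proj01 -filter_predI; congr map.
by apply: eq_filter => x /=; case: orP => // -[] /eqP->.
Qed.

Lemma size_sym01_closure (L : set (seq bool)) (k : nat) :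
  (forall u, L u -> size u <= k) -> forall u, sym01_closure L u -> size u <= k.
Proof. by move=> Lk u [/Lk//|[v /Lk vk <-]]; rewrite size_map. Qed.

Lemma finite_set_size_bounded (T : choiceType) (L : set (seq T)) :
  finite_set L -> exists k, forall u, L u -> size u <= k.
Proof.
move=> /finite_seqP[s ->]; exists (\max_(u <- s) size u) => u /= us.
exact: (leq_bigmax_seq u).
Qed.

Lemma size_sum_count_mem (T : finType) (s : seq T) :
  size s = \sum_(x : T) count_mem x s.
Proof.
elim: s => [|y s IHs] /=; first by rewrite big1.
rewrite big_split /= -IHs (bigD1 y) //= eqxx big1 ?addn0 //.
by move=> x; rewrite eq_sym => /negbTE->.
Qed.

Lemma seq_in_image (A B : eqType) (f : A -> B) (w : seq B) :
  (forall x, x \in w -> exists a, f a = x) -> exists w0, map f w0 = w.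
Proof.
elim: w => [|x w IHw] fw; first by exists [::].
have [|w0 <-] := IHw; first by move=> y yw; apply: fw; rewrite inE yw orbT.
by have [|a <-] := fw x; [rewrite mem_head | exists (a :: w0)].
Qed.

Definition light (A : eqType) (k : nat) (w : seq A) : seq A :=
  [seq x <- w | count_mem x w <= k].

(** Each letter of [T] either keeps all of its occurrences, at most [k] of them, or loses every
    one. *)
Lemma size_light (T : finType) (k : nat) (w : seq T) :
  size (light k w) <= k * #|T|.
Proof.
rewrite size_sum_count_mem mulnC -sum_nat_const; apply: leq_sum => x _.
rewrite /light count_filter; have [xk|xk] := leqP (count_mem x w) k.
  by apply: leq_trans xk; apply: sub_count => y /andP[].
rewrite [X in X <= _](_ : _ = 0) //; apply/eqP; rewrite -leqn0 leqNgt -has_count.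
by apply/hasPn => y _ /=; case: eqP => //= ->; rewrite -ltnNge.
Qed.

(* A letter missing from [light k w] may still have a projection in [L]
   against another letter, hence the membership conditions. *)
Lemma proj01_light (L : set (seq bool)) (k : nat) (A : eqType) (w : seq A)
    (a b : A) :
  (forall u, L u -> size u <= k) -> a != b -> a \in w -> b \in w ->
  L (proj01 a b w) <->
  [/\ a \in light k w, b \in light k w & L (proj01 a b (light k w))].
Proof.
move=> Lk ab aw bw; rewrite !mem_filter aw bw !andbT; split=> [Lab|[ak bk]].
  have := Lk _ Lab; rewrite size_proj01 // => abk.
  have ak : count_mem a w <= k by apply: leq_trans abk; rewrite leq_addr.
  have bk : count_mem b w <= k by apply: leq_trans abk; rewrite leq_addl.
  by split=> //; rewrite proj01_filter.
by rewrite proj01_filter.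
Qed.

(** Every edge is a set of two distinct vertices, so sets of any other size lie in neither edge
    set. *)
Lemma sgraph_adj_inj (V : finType) (G H : sgraph V) :
  (forall u v, u != v -> adj G u v = adj H u v) -> G = H.
Proof.
move=> GH; apply/val_inj/setP => e /=.
have [/cards2P[u [v [uv ->]]]|e2] := boolP (#|e| == 2); first exact: GH.
have nonedge (K : sgraph V) : (e \in edges K) = false.
  by apply: contraNF e2; apply: (forall_inP (edges_card2 K)).
by rewrite !nonedge.
Qed.

Section LetterGraph.
Variables (L : set (seq bool)) (V : finType) (w : seq V).

(** The vertex set is all of [V] rather than [seq_sub w], so that letters deleted from a word remain
    as isolated vertices. *)
Definition letter_edges : {set {set V}} :=
  [set e : {set V} | [exists u : V, exists v : V,
     [&& e == [set u; v], u != v, u \in w, v \in w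
       & `[< L (proj01 u v w) >]]]]%SET.

Fact letter_edges_card2 : [forall e in letter_edges, #|e| == 2].
Proof.
apply/forall_inP => e; rewrite inE => /existsP[u /existsP[v]].
by case/and3P => /eqP-> uv _; rewrite cards2 uv.
Qed.

Definition letter_graph : sgraph V := SGraph letter_edges_card2.

Lemma adj_letter_graph (u v : V) : sym01 L -> u != v ->
  adj letter_graph u v <-> [/\ u \in w, v \in w & L (proj01 u v w)].
Proof.
move=> symL uv; split; last first.
  move=> [uw vw Luv]; rewrite /adj inE; apply/existsP; exists u.
  by apply/existsP; exists v; rewrite eqxx uv uw vw; apply/asboolP.
rewrite /adj inE => /existsP[a /existsP[b]].
case/and5P => /eqP E ab aw bw /asboolP Lab.
have /set2P[ua|ub] : u \in [set a; b]%SET by rewrite -E set21.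
  have /set2P[va|->] : v \in [set a; b]%SET by rewrite -E set22.
    by rewrite ua va eqxx in uv.
  by rewrite ua.
have /set2P[->|vb] : v \in [set a; b]%SET by rewrite -E set22.
  (* The edge was witnessed in the opposite order; exchanging the two letters flips the projection,
     and [L] is symmetric. *)
  rewrite ub; split=> //; rewrite symL; right.
  by exists (proj01 a b w) => //; apply: flip01_proj01.
by rewrite ub vb eqxx in uv.
Qed.

End LetterGraph.

(** The isomorphism renames the letters of the word to vertices of [G], and projections are
    invariant under injective renaming. This removes the arbitrary alphabet, so that words can be
    counted. *)
Lemma word_graph_class_letters (L : set (seq bool)) (V : finType)
    (G : sgraph V) :
  sym01 L -> word_graph_class L G ->
  exists2 w : seq V, (forall u, u \in w) & forall u v, u != v ->
    adj G u v <-> L (proj01 u v w).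
Proof.
move=> symL [A [w [f [g fK gK] fadj]]].
have injf : injective f := can_inj fK.
have inj : injective (fun u => val (f u)) by move=> u v /val_inj/injf.
have [x xw|w0 w0E] := @seq_in_image _ _ (fun u => val (f u)) w.
  by exists (g (SeqSub xw)); rewrite gK.
exists w0 => [u|u v uv]; first by rewrite -(mem_map inj) w0E; apply: valP.
rewrite -(proj01_map _ _ _ inj) w0E -fadj.
by apply: adj_word_graph; rewrite // (inj_eq injf).
Qed.

Lemma word_graph_class_short (L : set (seq bool)) (k : nat) (V : finType)
    (G : sgraph V) :
  sym01 L -> (forall u, L u -> size u <= k) -> word_graph_class L G ->
  exists2 w : seq V, size w <= k * #|V| & G = letter_graph L w.
Proof.
move=> symL Lk /(word_graph_class_letters symL)[w wV Gw].
exists (light k w); first exact: size_light.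
apply: sgraph_adj_inj => u v uv; apply/idP/idP.
  move=> /(Gw _ _ uv)/(proj01_light Lk uv (wV u) (wV v)).
  by move/(adj_letter_graph _ symL uv).
move=> /(adj_letter_graph _ symL uv).
by move/(proj01_light Lk uv (wV u) (wV v))/(Gw _ _ uv).
Qed.

(** Padding with [None] encodes all words of length at most [m] as tuples of one fixed length; the
    extra symbol is why the base of the count is [n.+1]. *)
Lemma pmap_id_tuple (T : Type) (m : nat) (s : seq T) :
  size s <= m -> exists t : m.-tuple (option T), pmap id t = s.
Proof.
move=> sm; have st : size (map Some s ++ nseq (m - size s) None) == m.
  by rewrite size_cat size_map size_nseq subnKC.
exists (Tuple st); rewrite /= pmap_cat map_pK //.
by elim: (m - _) => [|j]; rewrite /= ?cats0.
Qed.

Lemma speed_le_words (L : set (seq bool)) (k n : nat) :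
  sym01 L -> (forall u, L u -> size u <= k) ->
  speed (word_graph_class L) n <= n.+1 ^ (k * n).
Proof.
move=> symL Lk.
have <- : #|{: (k * n).-tuple (option 'I_n)}| = n.+1 ^ (k * n).
  by rewrite card_tuple card_option card_ord.
apply: leq_trans (leq_imset_card
  (fun t : (k * n).-tuple (option 'I_n) => letter_graph L (pmap id t)) _).
apply: subset_leq_card; apply/fintype.subsetP => G; rewrite inE => /asboolP.
move=> /(word_graph_class_short symL Lk)[w]; rewrite card_ord.
by move=> /pmap_id_tuple[t <-] ->; apply: imset_f.
Qed.

(** Treats the small cases, where a power of [n.+1] cannot be absorbed into a power of [n]: there
    are no two distinct vertices, hence only one graph. *)
Lemma speed_le1 (C : graph_class) (n : nat) : n <= 1 -> speed C n <= 1.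
Proof.
move=> n1; rewrite /speed; apply/card_le1_eqP => G H _ _.
apply: sgraph_adj_inj => u v /negP[]; apply/eqP/val_inj => /=.
have ord_eq0 (i : 'I_n) : val i = 0.
  by apply/eqP; rewrite -leqn0 -ltnS (leq_trans (ltn_ord i)).
by rewrite !ord_eq0.
Qed.

Lemma speed_sym01_closure (L : set (seq bool)) : finite_set L ->
  exists2 c : nat, 0 < c & forall n,
    speed (word_graph_class (sym01_closure L)) n <= n ^ (c * n).
Proof.
move=> /finite_set_size_bounded[k /size_sym01_closure Lk].
(* For [n >= 2], [n.+1 <= n ^ 2] turns the word count into [n ^ (2 * k * n)]; the successor keeps
   the constant positive when [k = 0]. *)
exists (2 * k).+1 => // n; have [n1|n2] := leqP n 1.
  apply: leq_trans (speed_le1 _ n1) _.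
  (* The bound equals 1 in both cases, for [n = 0] because [0 ^ 0 = 1]. *)
  by case: n n1 => [|[|]] // _; rewrite ?muln0 ?exp1n.
apply: leq_trans (speed_le_words n (sym01_closureP L) Lk) _.
have n_sq : n.+1 <= n ^ 2.
  apply: leq_trans (leq_mul n2 (leqnn n)).
  by rewrite mul2n -addnn -add1n leq_add2r ltnW.
apply: leq_trans (leq_pexp2l (ltnW n2) _ : n ^ (2 * (k * n)) <= _).
  by rewrite (expnM n 2); case: (k * n) => // j; rewrite leq_exp2r.
by rewrite mulnA leq_mul.
Qed.

Theorem theorem1 (R : realType) (L : set (seq bool)) (finL : finite_set L) :
  (exists c : R, (0 < c)%R /\
     forall n : nat, (2 <= n)%N ->
       ((speed (word_graph_class (sym01_closure L)) n)%:R
          <= n%:R `^ (c * n%:R))%R) /\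
  at_most_factorial_speed R (word_graph_class (sym01_closure L)).
Proof.
have [c c0 Lc] := speed_sym01_closure finL.
suff H : at_most_factorial_speed R (word_graph_class (sym01_closure L)).
  by split=> //; have [d [d0 Ld]] := H; exists d; split=> // n _.
exists c%:R%R; split=> [|n]; first by rewrite Num.Theory.ltr0n.
(* The exponent is a natural number, so the real power is the ordinary one, including [0 ^ 0 = 1] at
   [n = 0]. *)
rewrite -GRing.natrM powR_mulrn ?Num.Theory.ler0n // -GRing.natrX.
by rewrite Num.Theory.ler_nat.
Qed.
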